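(* Consider the system of ionized gas dynamics described in the context. The eigenvalues $\lambda_\pm$ are genuinely nonlinear if $\alpha\ge\frac12$. If $\alpha<\frac12$, they are no more genuinely nonlinear for suitably small values of $p$ and $T$.
   Context: Fix positive constants $a^2$ (specific gas constant), $T_{\rm i}$ (ionization temperature) and $\kappa$. Thermodynamic states are described by pressure $p>0$ and temperature $T>0$; the degree of ionization is $\alpha=\alpha(p,T)=\left(1+\kappa pT^{-5/2}e^{T_{\rm i}/T}\right)^{-1/2}\in(0,1)$. The specific volume is $v=a^2(1+\alpha)T/p$, the specific internal energy is $e=a^2\left[\frac32(1+\alpha)T+T_{\rm i}\alpha\right]$, and $\eta=S/a^2$ is the dimensionless entropy, where $T\,dS=de+p\,dv$; up to an additive constant $\eta=-2\log\frac{1-\alpha}{\alpha}+(1+\alpha)\left(\frac52+\frac{T_{\rm i}}{T}\right)$. The system in Lagrangian coordinates, with $u$ the velocity, is $v_t-u_\xi=0$, $u_t+p_\xi=0$, $\left(e+\frac12u^2\right)_t+(pu)_\xi=0$. Its eigenvalues are $\lambda_\pm=\pm\lambda$ and $\lambda_0=0$, where $\lambda>0$ and $$\lambda^2=-\frac{\eta_T}{v_p\eta_T-v_T\eta_p}=\frac{p^2\left[\frac52+\frac12\alpha(1-\alpha)\left(\frac52+\frac{T_{\rm i}}{T}\right)^2\right]}{a^2T(1+\alpha)\left[\frac32+\frac12\alpha(1-\alpha)\left(\frac{15}{4}+\frac{3T_{\rm i}}{T}+\frac{T_{\rm i}^2}{T^2}\right)\right]}$$ (subscripts are partial derivatives in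 the variables $(p,T)$). With the eigenvectors $R_\pm=\left(\pm1,\frac1\lambda,\mp\frac{\eta_p}{\eta_T}\right)^T$ in the variables $(p,u,T)$, the derivative of a function of $(p,T)$ along the $\pm$ characteristic field is $R_\pm\nabla=\pm\left(\frac{\partial}{\partial p}-\frac{\eta_p}{\eta_T}\frac{\partial}{\partial T}\right)$; one has $R_+\nabla\lambda_+=R_-\nabla\lambda_-$. The eigenvalues $\lambda_\pm$ are genuinely nonlinear where $R_\pm\nabla\lambda_\pm>0$. *)

(* Defs.v *)
From Stdlib Require Import Reals Lra Psatz.
From Coquelicot Require Import Coquelicot.
Open Scope R_scope.

(* [a2] is the constant written a^2 (specific gas constant), [Ti] the
   ionization temperature, [kappa] the constant in Saha's law. *)
Record gas : Type := Gas {
  a2 : R;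
  Ti : R;
  kappa : R;
  a2_pos : 0 < a2;
  Ti_pos : 0 < Ti;
  kappa_pos : 0 < kappa
}.

Definition alpha (g : gas) (p T : R) : R :=
  / sqrt (1 + kappa g * p * Rpower T (- (5 / 2)) * exp (Ti g / T)).

Definition volume (g : gas) (p T : R) : R :=
  a2 g * (1 + alpha g p T) * T / p.

Definition energy (g : gas) (p T : R) : R :=
  a2 g * (3 / 2 * (1 + alpha g p T) * T + Ti g * alpha g p T).

Definition eta (g : gas) (p T : R) : R :=
  - 2 * ln ((1 - alpha g p T) / alpha g p T)
  + (1 + alpha g p T) * (5 / 2 + Ti g / T).

Definition dp (f : R -> R -> R) (p T : R) : R := Derive (fun p' => f p' T) p.
Definition dT (f : R -> R -> R) (p T : R) : R := Derive (fun T' => f p T') T.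

Definition lambda_sqr (g : gas) (p T : R) : R :=
  - dT (eta g) p T
  / (dp (volume g) p T * dT (eta g) p T - dT (volume g) p T * dp (eta g) p T).

Definition lambda (g : gas) (p T : R) : R := sqrt (lambda_sqr g p T).

(* Directional derivative of a function of (p, u, T) along r. *)
Definition along (r : R * R * R) (f : R -> R -> R -> R) (p u T : R) : R :=
  let '(rp, ru, rT) := r in
  rp * Derive (fun p' => f p' u T) p
  + ru * Derive (fun u' => f p u' T) u
  + rT * Derive (fun T' => f p u T') T.

(* The system W_t + F_xi = 0 has (W, F) = (v, -u), (u, p), (e + u^2/2, p u);
   its eigenpairs in the variables (p, u, T) solve DF r = lam DW r. *)
Definition eigenpair (g : gas) (p u T lam : R) (r : R * R * R) : Prop :=
  r <> (0, 0, 0) /\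
  along r (fun _ u _ => - u) p u T
    = lam * along r (fun p _ T => volume g p T) p u T /\
  along r (fun p _ _ => p) p u T
    = lam * along r (fun _ u _ => u) p u T /\
  along r (fun p u _ => p * u) p u T
    = lam * along r (fun p u T => energy g p T + u ^ 2 / 2) p u T.

Inductive wave_family : Set := forward | backward.

Definition sgn (s : wave_family) : R := match s with forward => 1 | backward => -1 end.

Definition lambda_pm (g : gas) (s : wave_family) (p u T : R) : R :=
  sgn s * lambda g p T.

Definition R_pm (g : gas) (s : wave_family) (p T : R) : R * R * R :=
  (sgn s, 1 / lambda g p T, - sgn s * (dp (eta g) p T / dT (eta g) p T)).

Definition genuinely_nonlinear (g : gas) (s : wave_family) (p u T : R) : Prop :=
  along (R_pm g s p T) (lambda_pm g s) p u T > 0.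

Lemma alpha_bounds g p T : 0 < p -> 0 < alpha g p T < 1.
Proof.
intros hp; unfold alpha.
pose proof (kappa_pos g).
assert (0 < kappa g * p * Rpower T (- (5 / 2)) * exp (Ti g / T)).
{ repeat apply Rmult_lt_0_compat; auto; apply exp_pos. }
assert (1 < sqrt (1 + kappa g * p * Rpower T (- (5 / 2)) * exp (Ti g / T))).
{ apply Rle_lt_trans with (sqrt 1); [rewrite sqrt_1 | apply sqrt_lt_1]; lra. }
split; [apply Rinv_0_lt_compat; lra |].
apply Rlt_le_trans with (/ 1); [apply Rinv_lt_contravar | rewrite Rinv_1]; lra.
Qed.

Lemma is_derive_alpha_p g p T : 0 < p ->
  is_derive (fun p' => alpha g p' T) p
    (- (alpha g p T * (1 - alpha g p T ^ 2) / (2 * p))).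
Proof.
intros hp; unfold alpha.
pose proof (kappa_pos g).
set (k := kappa g * Rpower T (- (5 / 2)) * exp (Ti g / T)).
assert (hk : 0 < k).
{ unfold k; repeat apply Rmult_lt_0_compat; auto; apply exp_pos. }
apply is_derive_ext with (fun p' => / sqrt (1 + k * p')).
{ intros t; replace (k * t)
    with (kappa g * t * Rpower T (- (5 / 2)) * exp (Ti g / T))
    by (unfold k; ring); reflexivity. }
replace (kappa g * p * Rpower T (- (5 / 2)) * exp (Ti g / T)) with (k * p)
  by (unfold k; ring).
assert (h : 0 < 1 + k * p) by nra.
assert (hs : 0 < sqrt (1 + k * p)) by (apply sqrt_lt_R0; lra).
auto_derive; [split; [lra | split; auto; lra] |].
assert (hq : sqrt (1 + k * p) * sqrt (1 + k * p) = 1 + k * p)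
  by (apply sqrt_sqrt; lra).
set (q := sqrt (1 + k * p)) in *.
replace k with ((q * q - 1) / p) by (rewrite hq; field; lra).
field; lra.
Qed.

Lemma is_derive_alpha_T g p T : 0 < p -> 0 < T ->
  is_derive (fun T' => alpha g p T') T
    (alpha g p T * (1 - alpha g p T ^ 2) * (5 / 2 + Ti g / T) / (2 * T)).
Proof.
intros hp hT; unfold alpha, Rpower.
pose proof (kappa_pos g).
set (k := kappa g * p * exp (- (5 / 2) * ln T) * exp (Ti g / T)).
assert (hk : 0 < k).
{ unfold k; repeat apply Rmult_lt_0_compat; auto; apply exp_pos. }
assert (hs : 0 < sqrt (1 + k)) by (apply sqrt_lt_R0; lra).
auto_derive; fold (Rdiv (Ti g) T); fold k;
  [repeat split; auto; try lra |].
assert (hq : sqrt (1 + k) * sqrt (1 + k) = 1 + k) by (apply sqrt_sqrt; lra).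
set (q := sqrt (1 + k)) in *.
match goal with |- ?l = _ =>
  replace l with (k * (5 / 2 + Ti g / T) / T * / (2 * q) * / (q * q)) end.
{ replace k with (q * q - 1) by lra; field; lra. }
unfold k; field; lra.
Qed.

Lemma is_derive_eta_p g p T : 0 < p ->
  is_derive (fun p' => eta g p' T) p
    (- ((1 + alpha g p T)
        * (1 + alpha g p T * (1 - alpha g p T) / 2 * (5 / 2 + Ti g / T)) / p)).
Proof.
intros hp; unfold eta.
pose proof (alpha_bounds g p T hp) as ha.
pose proof (is_derive_alpha_p g p T hp) as hd.
assert (0 < (1 - alpha g p T) / alpha g p T) by (apply Rdiv_lt_0_compat; lra).
auto_derive.
{ repeat split; auto; try lra; eexists; apply hd. }
replace (Derive _ p) with (- (alpha g p T * (1 - alpha g p T ^ 2) / (2 * p)))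
  by (symmetry; apply is_derive_unique, hd).
set (a := alpha g p T) in *; set (x := Ti g / T).
unfold Rdiv in x; fold x; field; lra.
Qed.

Lemma is_derive_eta_T g p T : 0 < p -> 0 < T ->
  is_derive (fun T' => eta g p T') T
    ((1 + alpha g p T)
     * (5 / 2 + alpha g p T * (1 - alpha g p T) / 2 * (5 / 2 + Ti g / T) ^ 2) / T).
Proof.
intros hp hT; unfold eta.
pose proof (alpha_bounds g p T hp) as ha.
pose proof (is_derive_alpha_T g p T hp hT) as hd.
assert (0 < (1 - alpha g p T) / alpha g p T) by (apply Rdiv_lt_0_compat; lra).
auto_derive.
{ repeat split; auto; try lra; eexists; apply hd. }
replace (Derive _ T) with
  (alpha g p T * (1 - alpha g p T ^ 2) * (5 / 2 + Ti g / T) / (2 * T))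
  by (symmetry; apply is_derive_unique, hd).
set (a := alpha g p T) in *; field; lra.
Qed.

Lemma is_derive_volume_p g p T : 0 < p ->
  is_derive (fun p' => volume g p' T) p
    (- (a2 g * T * (1 + alpha g p T)
        * (1 + alpha g p T * (1 - alpha g p T) / 2) / p ^ 2)).
Proof.
intros hp; unfold volume.
pose proof (is_derive_alpha_p g p T hp) as hd.
auto_derive.
{ repeat split; auto; try lra; eexists; apply hd. }
replace (Derive _ p) with (- (alpha g p T * (1 - alpha g p T ^ 2) / (2 * p)))
  by (symmetry; apply is_derive_unique, hd).
set (a := alpha g p T) in *; field; lra.
Qed.

Lemma is_derive_volume_T g p T : 0 < p -> 0 < T ->
  is_derive (fun T' => volume g p T') T
    (a2 g * (1 + alpha g p T)
     * (1 + alpha g p T * (1 - alpha g p T) / 2 * (5 / 2 + Ti g / T)) / p).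
Proof.
intros hp hT; unfold volume.
pose proof (is_derive_alpha_T g p T hp hT) as hd.
auto_derive.
{ repeat split; auto; try lra; eexists; apply hd. }
replace (Derive _ T) with
  (alpha g p T * (1 - alpha g p T ^ 2) * (5 / 2 + Ti g / T) / (2 * T))
  by (symmetry; apply is_derive_unique, hd).
set (a := alpha g p T) in *; field; lra.
Qed.

Lemma is_derive_energy_p g p T : 0 < p -> 0 < T ->
  is_derive (fun p' => energy g p' T) p
    (- (a2 g * T * (3 / 2 + Ti g / T)
        * (alpha g p T * (1 - alpha g p T ^ 2)) / (2 * p))).
Proof.
intros hp hT; unfold energy.
pose proof (is_derive_alpha_p g p T hp) as hd.
auto_derive.
{ repeat split; auto; try lra; eexists; apply hd. }
replace (Derive _ p) with (- (alpha g p T * (1 - alpha g p T ^ 2) / (2 * p)))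
  by (symmetry; apply is_derive_unique, hd).
set (a := alpha g p T) in *; field; lra.
Qed.

Lemma is_derive_energy_T g p T : 0 < p -> 0 < T ->
  is_derive (fun T' => energy g p T') T
    (a2 g * (1 + alpha g p T)
     * (3 / 2 + alpha g p T * (1 - alpha g p T) / 2
                * (3 / 2 + Ti g / T) * (5 / 2 + Ti g / T))).
Proof.
intros hp hT; unfold energy.
pose proof (is_derive_alpha_T g p T hp hT) as hd.
auto_derive.
{ repeat split; auto; try lra; eexists; apply hd. }
replace (Derive _ T) with
  (alpha g p T * (1 - alpha g p T ^ 2) * (5 / 2 + Ti g / T) / (2 * T))
  by (symmetry; apply is_derive_unique, hd).
set (a := alpha g p T) in *; field; lra.
Qed.

Lemma eta_T_pos g p T : 0 < p -> 0 < T -> 0 < dT (eta g) p T.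
Proof.
intros hp hT.
rewrite (is_derive_unique _ _ _ (is_derive_eta_T g p T hp hT)
         : dT (eta g) p T = _).
pose proof (alpha_bounds g p T hp).
assert (0 <= (5 / 2 + Ti g / T) ^ 2) by apply pow2_ge_0.
apply Rdiv_lt_0_compat; auto; apply Rmult_lt_0_compat; [lra |].
assert (0 < alpha g p T * (1 - alpha g p T) / 2) by nra.
nra.
Qed.

(* T dS = de + p dv with S = a^2 eta. *)
Lemma second_law g p T : 0 < p -> 0 < T ->
  T * (a2 g * dp (eta g) p T) = dp (energy g) p T + p * dp (volume g) p T /\
  T * (a2 g * dT (eta g) p T) = dT (energy g) p T + p * dT (volume g) p T.
Proof.
intros hp hT.
rewrite (is_derive_unique _ _ _ (is_derive_eta_p g p T hp)
         : dp (eta g) p T = _).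
rewrite (is_derive_unique _ _ _ (is_derive_eta_T g p T hp hT)
         : dT (eta g) p T = _).
rewrite (is_derive_unique _ _ _ (is_derive_volume_p g p T hp)
         : dp (volume g) p T = _).
rewrite (is_derive_unique _ _ _ (is_derive_volume_T g p T hp hT)
         : dT (volume g) p T = _).
rewrite (is_derive_unique _ _ _ (is_derive_energy_p g p T hp hT)
         : dp (energy g) p T = _).
rewrite (is_derive_unique _ _ _ (is_derive_energy_T g p T hp hT)
         : dT (energy g) p T = _).
split; field; lra.
Qed.

Lemma lambda_sqr_closed_form g p T : 0 < p -> 0 < T ->
  lambda_sqr g p T =
  p ^ 2 * (5 / 2 + 1 / 2 * alpha g p T * (1 - alpha g p T)
                   * (5 / 2 + Ti g / T) ^ 2)
  / (a2 g * T * (1 + alpha g p T)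
     * (3 / 2 + 1 / 2 * alpha g p T * (1 - alpha g p T)
                * (15 / 4 + 3 * Ti g / T + Ti g ^ 2 / T ^ 2))).
Proof.
intros hp hT; unfold lambda_sqr.
rewrite (is_derive_unique _ _ _ (is_derive_eta_p g p T hp)
         : dp (eta g) p T = _).
rewrite (is_derive_unique _ _ _ (is_derive_eta_T g p T hp hT)
         : dT (eta g) p T = _).
rewrite (is_derive_unique _ _ _ (is_derive_volume_p g p T hp)
         : dp (volume g) p T = _).
rewrite (is_derive_unique _ _ _ (is_derive_volume_T g p T hp hT)
         : dT (volume g) p T = _).
pose proof (alpha_bounds g p T hp) as ha.
pose proof (a2_pos g) as hA.
assert (hx : 0 < Ti g / T) by (apply Rdiv_lt_0_compat; auto; apply Ti_pos).
replace (3 * Ti g / T + Ti g ^ 2 / T ^ 2)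
  with (3 * (Ti g / T) + (Ti g / T) ^ 2) by (field; lra).
replace (15 / 4 + 3 * Ti g / T + Ti g ^ 2 / T ^ 2)
  with (15 / 4 + 3 * (Ti g / T) + (Ti g / T) ^ 2) by (field; lra).
set (a := alpha g p T) in *; set (x := Ti g / T) in *.
assert (hD : 0 < 3 / 2 + 1 / 2 * a * (1 - a) * (15 / 4 + 3 * x + x ^ 2)).
{ assert (0 < a * (1 - a)) by nra.
  assert (0 < 15 / 4 + 3 * x + x ^ 2) by nra. nra. }
match goal with |- - ?N / ?D = _ =>
  replace D with (- (a2 g * (1 + a) ^ 2
    * (3 / 2 + 1 / 2 * a * (1 - a) * (15 / 4 + 3 * x + x ^ 2)) / p ^ 2))
    by (field; lra) end.
set (d := 3 / 2 + _) in *.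
field; repeat split; lra.
Qed.

Lemma lambda_sqr_pos g p T : 0 < p -> 0 < T -> 0 < lambda_sqr g p T.
Proof.
intros hp hT; rewrite lambda_sqr_closed_form; auto.
pose proof (alpha_bounds g p T hp) as ha.
pose proof (a2_pos g) as hA.
assert (hx : 0 < Ti g / T) by (apply Rdiv_lt_0_compat; auto; apply Ti_pos).
replace (15 / 4 + 3 * Ti g / T + Ti g ^ 2 / T ^ 2)
  with (15 / 4 + 3 * (Ti g / T) + (Ti g / T) ^ 2) by (field; lra).
set (a := alpha g p T) in *; set (x := Ti g / T) in *.
assert (0 < a * (1 - a)) by nra.
assert (0 < (5 / 2 + x) ^ 2) by nra.
assert (0 < 15 / 4 + 3 * x + x ^ 2) by nra.
apply Rdiv_lt_0_compat; repeat apply Rmult_lt_0_compat; nra.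
Qed.

Lemma eigenpair_pm g s p u T : 0 < p -> 0 < T ->
  eigenpair g p u T (lambda_pm g s p u T) (R_pm g s p T).
Proof.
intros hp hT.
pose proof (lambda_sqr_pos g p T hp hT) as hl2.
assert (hl : 0 < lambda g p T) by (apply sqrt_lt_R0; auto).
assert (hll : lambda g p T * lambda g p T = lambda_sqr g p T)
  by (apply sqrt_sqrt; lra).
pose proof (eta_T_pos g p T hp hT) as heT.
destruct (second_law g p T hp hT) as [hSp hST].
unfold eigenpair, along, R_pm, lambda_pm.
split; [intros E; injection E; destruct s; simpl; lra |].
assert (hc : forall (f : R -> R) (c x : R), ex_derive f x ->
  Derive (fun y => f y + c) x = Derive f x).
{ intros f c x hf; rewrite (Derive_plus f (fun _ => c)), Derive_const; auto.
  - ring.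
  - apply ex_derive_const. }
assert (hEp : Derive (fun p' => energy g p' T + u ^ 2 / 2) p
              = dp (energy g) p T).
{ apply (hc (fun p' => energy g p' T)).
  eexists; apply is_derive_energy_p; auto. }
assert (hET : Derive (fun T' => energy g p T' + u ^ 2 / 2) T
              = dT (energy g) p T).
{ apply (hc (fun T' => energy g p T')).
  eexists; apply is_derive_energy_T; auto. }
assert (hEu : Derive (fun u' => energy g p T + u' ^ 2 / 2) u = u).
{ apply is_derive_unique; auto_derive; auto; field. }
rewrite hEp, hET, hEu.
rewrite !Derive_const, Derive_opp, !Derive_id.
fold (dp (volume g) p T) (dT (volume g) p T).
replace (Derive (fun p' => p' * u) p) with u
  by (symmetry; apply is_derive_unique; auto_derive; auto; ring).
replace (Derive (fun u' => p * u') u) with p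
  by (symmetry; apply is_derive_unique; auto_derive; auto; ring).
assert (key : dp (volume g) p T
  - dT (volume g) p T * (dp (eta g) p T / dT (eta g) p T)
  = - (1 / (lambda g p T * lambda g p T))).
{ rewrite hll; unfold lambda_sqr in *.
  set (D := dp (volume g) p T * _ - _) in *.
  assert (D <> 0).
  { intros E; rewrite E in hl2; unfold Rdiv in hl2.
    rewrite Rinv_0 in hl2; lra. }
  replace (- (1 / (- dT (eta g) p T / D))) with (D / dT (eta g) p T)
    by (field; lra).
  unfold D; field; lra. }
replace (dp (energy g) p T)
  with (T * (a2 g * dp (eta g) p T) - p * dp (volume g) p T) by lra.
replace (dT (energy g) p T)
  with (T * (a2 g * dT (eta g) p T) - p * dT (volume g) p T) by lra.
replace (dp (volume g) p T) with
  (dT (volume g) p T * (dp (eta g) p T / dT (eta g) p T)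
   - 1 / (lambda g p T * lambda g p T)) by lra.
destruct s; simpl; repeat split; field; lra.
Qed.

(* Main.v *)
Require Import Defs.
From Stdlib Require Import Reals Lra Psatz.
From Coquelicot Require Import Coquelicot.
Open Scope R_scope.

(** Write [a] for the degree of ionization and [x = Ti / T].  Then
    [lambda ^ 2 = p ^ 2 / (a2 * T) * N / ((1 + a) * D)], where [N] ([lnum]) and
    [D] ([lden]) depend on [(a, x)] only.  Differentiating the logarithm of this product
    along the characteristic field, whose direction is tangent to the curves
    of constant entropy, gives

      [R_pm nabla lambda_pm = lambda / (2 p N ^ 2 D) * H (a, x)],

      [H = (4 + w (2 x ^ 2 + 8 x + 10)) N D
           + w x ^ 2 (2 (1 + w (5/2 + x)) ^ 2 - (1 - 2 a) (1 + a) / 2 * x)],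

    with [w = a (1 - a) / 2 > 0] ([along_lambda_pm]).  The sign is that of [H],
    and the only term of [H] that can be negative carries the factor [1 - 2 a].

    - If [a >= 1/2] that term is nonnegative, hence [H > 0]
      ([nonlinearity_pos]).

    - If [a < 1/2] the term is of order [- w x ^ 3].  It wins over the others
      when [x] is large while [w x ^ 2] stays of order one, for then [N], [D]
      and the other terms are bounded: this happens at [a = 1 / x ^ 2]
      ([nonlinearity_neg]).  Saha's law gives the pressure at which the
      ionization takes this value at temperature [T = Ti / x]; this pressure
      tends to [0] with [T] because [exp x] grows faster than [x ^ 4]
      ([weak_ionization_state]). *)

(** * The function deciding the sign *)

Definition weight (a : R) : R := a * (1 - a) / 2.

Definition lnum (a x : R) : R := 5 / 2 + weight a * (5 / 2 + x) ^ 2.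

Definition lden (a x : R) : R := 3 / 2 + weight a * (15 / 4 + 3 * x + x ^ 2).

Definition nonlinearity (a x : R) : R :=
  (4 + weight a * (2 * x ^ 2 + 8 * x + 10)) * (lnum a x * lden a x)
  + weight a * x ^ 2
    * (2 * (1 + weight a * (5 / 2 + x)) ^ 2 - (1 - 2 * a) * (1 + a) / 2 * x).

Lemma weight_pos a : 0 < a < 1 -> 0 < weight a.
Proof. unfold weight; nra. Qed.

Lemma lnum_pos a x : 0 < a < 1 -> 0 < lnum a x.
Proof.
intros ha; pose proof (weight_pos a ha); unfold lnum.
pose proof (pow2_ge_0 (5 / 2 + x)); nra.
Qed.

Lemma lden_pos a x : 0 < a < 1 -> 0 < lden a x.
Proof.
intros ha; pose proof (weight_pos a ha); unfold lden.
pose proof (pow2_ge_0 (x + 3 / 2)).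
assert (0 < 15 / 4 + 3 * x + x ^ 2) by lra; nra.
Qed.

Lemma nonlinearity_pos a x :
  1 / 2 <= a < 1 -> 0 < x -> 0 < nonlinearity a x.
Proof.
intros ha hx; unfold nonlinearity.
assert (ha' : 0 < a < 1) by (split; lra).
pose proof (weight_pos a ha') as hw.
assert (0 < lnum a x * lden a x)
  by (apply Rmult_lt_0_compat; [apply lnum_pos | apply lden_pos]; auto).
pose proof (pow2_ge_0 x).
assert (0 < weight a * (2 * x ^ 2 + 8 * x + 10))
  by (apply Rmult_lt_0_compat; lra).
assert (0 <= weight a * x ^ 2) by (apply Rmult_le_pos; lra).
assert (0 <= (2 * a - 1) * (1 + a) / 2 * x)
  by (repeat apply Rmult_le_pos; lra).
pose proof (pow2_ge_0 (1 + weight a * (5 / 2 + x))).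
apply Rplus_lt_le_0_compat.
- apply Rmult_lt_0_compat; lra.
- apply Rmult_le_pos; lra.
Qed.

(** At [a = 1 / x ^ 2] the product [w x ^ 2] lies just below [1 / 2], so all
    the positive terms of [H] are bounded independently of [x], whereas the
    negative one is about [- x / 4].  The threshold is not optimal. *)
Lemma nonlinearity_neg x : 1000 <= x -> nonlinearity (/ x ^ 2) x < 0.
Proof.
intros hx; unfold nonlinearity, lnum, lden.
set (r := / x).
assert (hr : 0 < r <= / 1000)
  by (split; [apply Rinv_0_lt_compat | apply Rinv_le_contravar]; lra).
assert (hrx : r * x = 1) by (apply Rinv_l; lra).
replace (/ x ^ 2) with (r ^ 2) by (unfold r; field; lra).
set (w := weight (r ^ 2)).
assert (hw2 : w * x ^ 2 = (1 - r ^ 2) / 2).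
{ transitivity ((r * x) ^ 2 * (1 - r ^ 2) / 2);
    [unfold w, weight; field | rewrite hrx; field]. }
assert (hw1 : w * x = r * (1 - r ^ 2) / 2).
{ transitivity ((r * x) * r * (1 - r ^ 2) / 2);
    [unfold w, weight; field | rewrite hrx; field]. }
assert (hw0 : 0 <= w <= / 1000) by (unfold w, weight; nra).
assert (hr2 : 0 <= r ^ 2 <= / 1000) by nra.
assert (hw1b : 0 <= w * x <= / 1000) by (rewrite hw1; nra).
assert (hw2b : 49 / 100 <= w * x ^ 2 <= 1 / 2) by lra.
assert (hN : 0 <= 5 / 2 + w * (5 / 2 + x) ^ 2 <= 31 / 10).
{ replace (w * (5 / 2 + x) ^ 2)
    with (25 / 4 * w + 5 * (w * x) + w * x ^ 2) by field; lra. }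
assert (hD : 0 <= 3 / 2 + w * (15 / 4 + 3 * x + x ^ 2) <= 21 / 10).
{ replace (w * (15 / 4 + 3 * x + x ^ 2))
    with (15 / 4 * w + 3 * (w * x) + w * x ^ 2) by field; lra. }
assert (hP : 0 <= 4 + w * (2 * x ^ 2 + 8 * x + 10) <= 6).
{ replace (w * (2 * x ^ 2 + 8 * x + 10))
    with (10 * w + 8 * (w * x) + 2 * (w * x ^ 2)) by field; lra. }
assert (hM : 2 * (1 + w * (5 / 2 + x)) ^ 2 <= 3).
{ replace (w * (5 / 2 + x)) with (5 / 2 * w + w * x) by field; nra. }
assert (hc : 49 / 100 * x <= (1 - 2 * r ^ 2) * (1 + r ^ 2) / 2 * x)
  by (apply Rmult_le_compat_r; nra).
set (N := 5 / 2 + _) in *; set (D := 3 / 2 + _) in *.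
set (P := 4 + _) in *; set (M := 2 * _ ^ 2) in *.
assert (N * D <= 7) by nra.
assert (0 <= N * D) by nra.
assert (P * (N * D) <= 42) by nra.
nra.
Qed.

(** * The derivative along the characteristic fields *)

(** Logarithmic differentiation of [lambda] along any curve in the state space;
    its two partial derivatives are the cases of the coordinate lines.  The
    coefficients of [da] and [dx] are short because [N] and [D] are affine in
    [w], so that in [N' D - N D'] most terms cancel: the derivative in [w]
    leaves [- x ^ 2], the one in [x] leaves [- 2 w x (1 + w (5/2 + x))]. *)
Lemma is_derive_sound_speed (A : R) (a x p T : R -> R) (t da dx dp dT : R) :
  0 < A -> 0 < a t < 1 -> 0 < p t -> 0 < T t ->
  is_derive a t da -> is_derive x t dx -> is_derive p t dp -> is_derive T t dT ->
  let F := fun s => p s ^ 2 * lnum (a s) (x s)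
                    / (A * T s * (1 + a s) * lden (a s) (x s)) in
  is_derive (fun s => sqrt (F s)) t
    (sqrt (F t) / 2
     * (2 * dp / p t - dT / T t
        - da * ((1 - 2 * a t) / 2 * x t ^ 2 / (lnum (a t) (x t) * lden (a t) (x t))
                + / (1 + a t))
        - dx * (2 * weight (a t) * x t * (1 + weight (a t) * (5 / 2 + x t))
                / (lnum (a t) (x t) * lden (a t) (x t))))).
Proof.
intros hA ha hp hT da' dx' dp' dT' F.
pose proof (lnum_pos (a t) (x t) ha) as hN.
pose proof (lden_pos (a t) (x t) ha) as hD.
assert (hF : 0 < F t).
{ unfold F; apply Rdiv_lt_0_compat; repeat apply Rmult_lt_0_compat; nra. }
assert (hs : 0 < sqrt (F t)) by (apply sqrt_lt_R0; auto).
set (L := _ - dx * _).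
assert (hdF : is_derive F t (F t * L)).
{ unfold F, L, lnum, lden, weight in *.
  auto_derive.
  { repeat split; try (eexists; eassumption).
    apply Rgt_not_eq; repeat apply Rmult_lt_0_compat; lra. }
  rewrite (is_derive_unique _ _ _ da' : Derive (fun s => a s) t = _).
  rewrite (is_derive_unique _ _ _ dx' : Derive (fun s => x s) t = _).
  rewrite (is_derive_unique _ _ _ dp' : Derive (fun s => p s) t = _).
  rewrite (is_derive_unique _ _ _ dT' : Derive (fun s => T s) t = _).
  field; repeat split; lra. }
replace (sqrt (F t) / 2 * L) with (F t * L / (2 * sqrt (F t))).
- auto_derive.
  + repeat split; auto; eexists; apply hdF.
  + rewrite (is_derive_unique _ _ _ hdF : Derive (fun s => F s) t = _).
    field; lra.
- replace (F t * L) with (sqrt (F t) * sqrt (F t) * L)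
    by (rewrite sqrt_sqrt; lra).
  field; lra.
Qed.

Lemma lambda_closed_form g p T : 0 < p -> 0 < T ->
  lambda g p T =
  sqrt (p ^ 2 * lnum (alpha g p T) (Ti g / T)
        / (a2 g * T * (1 + alpha g p T) * lden (alpha g p T) (Ti g / T))).
Proof.
intros hp hT; unfold lambda; rewrite lambda_sqr_closed_form by auto.
f_equal; unfold lnum, lden, weight.
replace (15 / 4 + 3 * Ti g / T + Ti g ^ 2 / T ^ 2)
  with (15 / 4 + 3 * (Ti g / T) + (Ti g / T) ^ 2) by (field; lra).
f_equal; field; lra.
Qed.

(** What the variation of [a] contributes to [p d/dp] of [ln (lambda ^ 2)].  By
    Saha's law its contribution to [T d/dT] is [- (5/2 + x)] times as large. *)
Definition ionization_term (a x : R) : R :=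
  weight a * (1 + (1 - 2 * a) * (1 + a) / 2 * x ^ 2 / (lnum a x * lden a x)).

Lemma is_derive_lambda_p g p T : 0 < p -> 0 < T ->
  is_derive (fun p' => lambda g p' T) p
    (lambda g p T / (2 * p) * (2 + ionization_term (alpha g p T) (Ti g / T))).
Proof.
intros hp hT.
apply is_derive_ext_loc with (fun p' =>
  sqrt (p' ^ 2 * lnum (alpha g p' T) (Ti g / T)
        / (a2 g * T * (1 + alpha g p' T) * lden (alpha g p' T) (Ti g / T)))).
{ apply (filter_imp (fun p' => 0 < p')); [| apply (open_gt 0); auto].
  intros q hq; symmetry; apply lambda_closed_form; auto. }
rewrite lambda_closed_form by auto.
pose proof (alpha_bounds g p T hp) as ha.
pose proof (lnum_pos _ (Ti g / T) ha) as hN.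
pose proof (lden_pos _ (Ti g / T) ha) as hD.
evar_last.
{ apply (is_derive_sound_speed (a2 g) (fun p' => alpha g p' T)
    (fun _ => Ti g / T) (fun p' => p') (fun _ => T) p
    (- (alpha g p T * (1 - alpha g p T ^ 2) / (2 * p))) 0 1 0); auto.
  - apply a2_pos.
  - apply is_derive_alpha_p; auto.
  - apply (is_derive_const (Ti g / T) p).
  - apply (is_derive_id p).
  - apply (is_derive_const T p). }
cbv beta; unfold ionization_term.
set (a := alpha g p T) in *; set (x := Ti g / T) in *.
set (l := sqrt _); set (N := lnum a x) in *; set (D := lden a x) in *.
unfold weight; field; repeat split; lra.
Qed.

Lemma is_derive_lambda_T g p T : 0 < p -> 0 < T ->
  is_derive (fun T' => lambda g p T') T
    (let a := alpha g p T in let x := Ti g / T in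
     lambda g p T / (2 * T)
     * (2 * weight a * x ^ 2 * (1 + weight a * (5 / 2 + x)) / (lnum a x * lden a x)
        - 1 - (5 / 2 + x) * ionization_term a x)).
Proof.
intros hp hT.
apply is_derive_ext_loc with (fun T' =>
  sqrt (p ^ 2 * lnum (alpha g p T') (Ti g / T')
        / (a2 g * T' * (1 + alpha g p T') * lden (alpha g p T') (Ti g / T')))).
{ apply (filter_imp (fun T' => 0 < T')); [| apply (open_gt 0); auto].
  intros q hq; symmetry; apply lambda_closed_form; auto. }
rewrite lambda_closed_form by auto.
pose proof (alpha_bounds g p T hp) as ha.
pose proof (lnum_pos _ (Ti g / T) ha) as hN.
pose proof (lden_pos _ (Ti g / T) ha) as hD.
evar_last.
{ apply (is_derive_sound_speed (a2 g) (fun T' => alpha g p T')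
    (fun T' => Ti g / T') (fun _ => p) (fun T' => T') T
    (alpha g p T * (1 - alpha g p T ^ 2) * (5 / 2 + Ti g / T) / (2 * T))
    (- (Ti g / T) / T) 0 1); auto.
  - apply a2_pos.
  - apply is_derive_alpha_T; auto.
  - auto_derive; [lra | field; lra].
  - apply (is_derive_const p T).
  - apply (is_derive_id T). }
cbv beta zeta; unfold ionization_term.
set (a := alpha g p T) in *; set (x := Ti g / T) in *.
set (l := sqrt _); set (N := lnum a x) in *; set (D := lden a x) in *.
unfold weight; field; repeat split; lra.
Qed.

(** The signs of [lambda_pm] and of the field cancel, which gives one formula
    for both families.  One factor [N] of the denominator comes from
    [lambda], the other from [eta_T], which is [(1 + a) N / T]. *)
Lemma along_lambda_pm g s p u T : 0 < p -> 0 < T ->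
  along (R_pm g s p T) (lambda_pm g s) p u T =
  lambda g p T
  / (2 * p * lnum (alpha g p T) (Ti g / T) ^ 2 * lden (alpha g p T) (Ti g / T))
  * nonlinearity (alpha g p T) (Ti g / T).
Proof.
intros hp hT; unfold along, R_pm, lambda_pm.
rewrite Derive_const, !Derive_scal.
rewrite (is_derive_unique _ _ _ (is_derive_lambda_p g p T hp hT)
         : Derive (fun p' => lambda g p' T) p = _).
rewrite (is_derive_unique _ _ _ (is_derive_lambda_T g p T hp hT)
         : Derive (lambda g p) T = _).
rewrite (is_derive_unique _ _ _ (is_derive_eta_p g p T hp)
         : dp (eta g) p T = _).
rewrite (is_derive_unique _ _ _ (is_derive_eta_T g p T hp hT)
         : dT (eta g) p T = _).
pose proof (alpha_bounds g p T hp) as ha.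
pose proof (lnum_pos _ (Ti g / T) ha) as hN.
pose proof (lden_pos _ (Ti g / T) ha) as hD.
cbv zeta.
set (a := alpha g p T) in *; set (x := Ti g / T) in *.
set (l := lambda g p T).
rewrite Rmult_0_r, Rplus_0_r.
unfold nonlinearity, ionization_term, lnum, lden, weight in *.
destruct s; simpl sgn; field; repeat split; lra.
Qed.

Lemma genuinely_nonlinear_iff g s p u T : 0 < p -> 0 < T ->
  genuinely_nonlinear g s p u T <-> 0 < nonlinearity (alpha g p T) (Ti g / T).
Proof.
intros hp hT; unfold genuinely_nonlinear, Rgt.
rewrite along_lambda_pm by auto.
pose proof (alpha_bounds g p T hp) as ha.
pose proof (lnum_pos _ (Ti g / T) ha) as hN.
pose proof (lden_pos _ (Ti g / T) ha) as hD.
assert (hl : 0 < lambda g p T) by (apply sqrt_lt_R0, lambda_sqr_pos; auto).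
set (k := _ / _).
assert (hk : 0 < k).
{ apply Rdiv_lt_0_compat; auto.
  repeat apply Rmult_lt_0_compat; try lra; apply pow_lt; auto. }
split; intros h; nra.
Qed.

(** * States of weak ionization at low temperature *)

(** The constant is [5 ^ 5]: the bound is [y <= exp y] at [y = x / 5], raised to
    the fifth power. *)
Lemma pow4_exp_bound x : 0 < x -> x ^ 4 * exp (- x) <= 3125 / x.
Proof.
intros hx.
assert (h : (x / 5) ^ 5 <= exp x).
{ replace (exp x) with (exp (x / 5) ^ 5).
  - apply pow_incr; pose proof (exp_ineq1 (x / 5)); lra.
  - rewrite <- Rpower_pow by apply exp_pos; unfold Rpower; rewrite ln_exp.
    f_equal; simpl INR; field. }
rewrite exp_Ropp.
pose proof (exp_pos x).
apply Rmult_le_reg_r with (x * exp x); [nra |].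
replace (x ^ 4 * / exp x * (x * exp x)) with (3125 * (x / 5) ^ 5)
  by (field; lra).
replace (3125 / x * (x * exp x)) with (3125 * exp x) by (field; lra).
lra.
Qed.

(** Saha's law solved for the pressure at which [a = 1 / x ^ 2], namely
    [(x ^ 4 - 1) T ^ (5/2) exp (- x) / kappa].  The bound on it is linear in
    [T], hence as small as desired at low temperature. *)
Lemma weak_ionization_state g T : 0 < T <= 1 -> T < Ti g ->
  exists p, 0 < p <= 3125 * T / (Ti g * kappa g) /\
            alpha g p T = / (Ti g / T) ^ 2.
Proof.
intros hT hTi.
pose proof (kappa_pos g) as hk; pose proof (Ti_pos g).
set (x := Ti g / T).
assert (hx : 1 < x)
  by (apply Rmult_lt_reg_r with T; [| unfold x; field_simplify]; lra).
assert (hx2 : 1 < x ^ 2) by nra.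
assert (hx4 : 1 < x ^ 4) by (replace (x ^ 4) with (x ^ 2 * x ^ 2) by ring; nra).
set (c := Rpower T (5 / 2)).
assert (hc : 0 < c) by apply exp_pos.
assert (hc1 : c <= 1).
{ replace 1 with (Rpower 1 (5 / 2))
    by (unfold Rpower; rewrite ln_1, Rmult_0_r; apply exp_0).
  apply Rle_Rpower_l; lra. }
pose proof (exp_pos (- x)) as he.
exists ((x ^ 4 - 1) * c * exp (- x) / kappa g); repeat split.
- repeat apply Rmult_lt_0_compat; auto; try lra; apply Rinv_0_lt_compat; auto.
- replace (3125 * T / (Ti g * kappa g)) with (3125 / x / kappa g)
    by (unfold x; field; lra).
  apply Rmult_le_compat_r; [left; apply Rinv_0_lt_compat; auto |].
  apply Rle_trans with (2 := pow4_exp_bound x ltac:(lra)).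
  apply Rmult_le_compat_r; nra.
- unfold alpha; fold x.
  replace (1 + _) with (x ^ 2 * x ^ 2).
  + rewrite sqrt_square by lra; reflexivity.
  + rewrite Rpower_Ropp, exp_Ropp; fold c; pose proof (exp_pos x).
    field; lra.
Qed.

(** * Genuine nonlinearity and its loss *)

Theorem proposition4p1 (g : gas) :
  (forall (s : wave_family) (p u T : R), 0 < p -> 0 < T ->
     alpha g p T >= 1 / 2 -> genuinely_nonlinear g s p u T) /\
  (forall eps : R, 0 < eps ->
     exists p T : R, 0 < p < eps /\ 0 < T < eps /\ alpha g p T < 1 / 2 /\
       forall (s : wave_family) (u : R), ~ genuinely_nonlinear g s p u T).
Proof.
pose proof (Ti_pos g) as hTi; pose proof (kappa_pos g) as hk.
split.
- intros s p u T hp hT ha; apply genuinely_nonlinear_iff; auto.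
  pose proof (alpha_bounds g p T hp).
  apply nonlinearity_pos; [lra | apply Rdiv_lt_0_compat; auto].
- intros eps he.
  set (b := eps * (Ti g * kappa g) / 3125).
  assert (hb : 0 < b) by (unfold b; repeat apply Rmult_lt_0_compat; lra).
  (* The four bounds make [T] and [x = Ti / T] admissible and force both [T]
     and the pressure below [eps]. *)
  set (m := Rmin (Rmin 1 (Ti g / 1000)) (Rmin eps b)).
  assert (hm : 0 < m /\ m <= 1 /\ m <= Ti g / 1000 /\ m <= eps /\ m <= b).
  { unfold m; repeat split.
    - repeat apply Rmin_glb_lt; lra.
    - eapply Rle_trans; [apply Rmin_l | apply Rmin_l].
    - eapply Rle_trans; [apply Rmin_l | apply Rmin_r].
    - eapply Rle_trans; [apply Rmin_r | apply Rmin_l].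
    - eapply Rle_trans; [apply Rmin_r | apply Rmin_r]. }
  set (T := m / 2).
  assert (hT : 0 < T < m) by (unfold T; lra).
  destruct (weak_ionization_state g T) as [p [[hp hpb] ha]]; try lra.
  assert (hx : 1000 <= Ti g / T)
    by (apply Rmult_le_reg_r with T; [| field_simplify]; lra).
  exists p, T; split; [split; auto | split; [lra | split]].
  + apply Rle_lt_trans with (1 := hpb).
    apply Rmult_lt_reg_r with (Ti g * kappa g); [nra |].
    replace (3125 * T / (Ti g * kappa g) * (Ti g * kappa g)) with (3125 * T)
      by (field; lra).
    unfold b in hm; lra.
  + rewrite ha; replace (1 / 2) with (/ 2) by field.
    apply Rinv_lt_contravar; nra.
  + intros s u h; apply genuinely_nonlinear_iff in h; try lra.
    rewrite ha in h; pose proof (nonlinearity_neg _ hx); lra.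
Qed.
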